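(* Let $N\ge 1$, let $M=(m_{i,j})_{0\le i,j\le N}$ be a complex Hermitian $(N+1)\times(N+1)$ matrix, and let $$W:=\sum_{i,j=0}^N m_{i,j}\,|\widetilde{D_{N,i}}\rangle\langle\widetilde{D_{N,j}}|.$$ Then $W$ is a separability witness of the $N$-qubit bosonic system if and only if $M$ is a power positive matrix, i.e. $$\vec z^{\,\dagger}M\vec z\ge 0\quad\text{for all } z\in\mathbb{C},\ \text{where } \vec z=(1,z,z^2,\dots,z^N)^T\in\mathbb{C}^{N+1}.$$
   Context: Let $|0\rangle,|1\rangle$ be the standard orthonormal basis of $\mathbb{C}^2$. For $0\le n\le N$ the unnormalized $N$-qubit Dicke state is the vector $|D_{N,n}\rangle\in(\mathbb{C}^2)^{\otimes N}$ equal to the sum of all $\binom{N}{n}$ distinct standard basis vectors $|x_1\rangle\otimes\cdots\otimes|x_N\rangle$ with $x\in\{0,1\}^N$ having exactly $n$ entries equal to $0$; equivalently, $(|1\rangle+z|0\rangle)^{\otimes N}=\sum_{n=0}^N z^n|D_{N,n}\rangle$ for all $z\in\mathbb{C}$. The dual basis is $|\widetilde{D_{N,n}}\rangle:=\binom{N}{n}^{-1}|D_{N,n}\rangle$, so that $\langle D_{N,m}|\widetilde{D_{N,n}}\rangle=\delta_{m,n}$. The bosonic space $S\subseteq(\mathbb{C}^2)^{\otimes N}$ is the subspace of vectors invariant under every swap of two tensor factors, with orthogonal projection $P_S$; the Dicke states form a basis of $S$. A separability witness (also called separable witness) of the $N$-qubit bosonic system is a Hermitian operator $W$ on $(\mathbb{C}^2)^{\otimes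 N}$ with $W=P_SWP_S$ and $\operatorname{tr}\big(W(|\alpha\rangle\langle\alpha|)^{\otimes N}\big)\ge 0$ for all $|\alpha\rangle\in\mathbb{C}^2$. *)

(* Defs.v *)
From HB Require Import structures.
From mathcomp Require Import all_boot all_order all_fingroup all_algebra.
From mathcomp Require Import sesquilinear spectral.
From mathcomp Require Import complex.
From mathcomp Require Import reals.

Set Implicit Arguments.
Unset Strict Implicit.
Unset Printing Implicit Defensive.

Import Order.TTheory GRing.Theory Num.Theory.
Local Open Scope ring_scope.
Local Open Scope sesquilinear_scope.
Local Open Scope complex_scope.

(* The space (C^2)^{\otimes N} is realized as column vectors whose coordinates
   are the bit strings x : {ffun 'I_N -> 'I_2}, through the bijection
   enum_val / enum_rank with 'I_(qdim N). *)
Notation bitstring N := {ffun 'I_N -> 'I_2}.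
Notation qdim N := #|{: bitstring N}|.

Section OrthogonalProjection.
Variables (C : numClosedFieldType) (d : nat).

(* proj_ortho acts on row vectors from the right, hence the transpositions;
   orth_proj_mem, orth_proj_id and orth_proj_ortho characterize the result as
   the orthogonal projection onto U for the inner product u^* v on columns. *)
Definition orth_proj (U : {vspace 'cV[C]_d}) : 'M[C]_d :=
  (proj_ortho (\matrix_(i < \dim U) ((vbasis U)`_i)^T))^T.

Lemma mem_vbasis_mx (U : {vspace 'cV[C]_d}) (v : 'cV[C]_d) :
  (v \in U) = (v^T <= \matrix_(i < \dim U) ((vbasis U)`_i)^T)%MS.
Proof.
have trZ (a : C) (w : 'cV[C]_d) : (a *: w)^T = a *: w^T by rewrite linearZ.
apply/idP/idP => [vU | /submxP[a va]].
  rewrite (coord_vbasis vU) raddf_sum; apply: summx_sub => i _.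
  rewrite /= trZ; apply: scalemx_sub.
  by rewrite -[X in (X <= _)%MS](rowK (fun i => ((vbasis U)`_i)^T)) row_sub.
rewrite -[v]trmxK va mulmx_sum_row raddf_sum; apply: memv_suml => i _.
by rewrite /= rowK linearZ /= trmxK memvZ // vbasis_mem // mem_nth ?size_tuple.
Qed.

Lemma orth_proj_mem (U : {vspace 'cV[C]_d}) (v : 'cV[C]_d) :
  orth_proj U *m v \in U.
Proof. by rewrite mem_vbasis_mx trmx_mul trmxK proj_ortho_sub. Qed.

Lemma orth_proj_id (U : {vspace 'cV[C]_d}) (v : 'cV[C]_d) :
  v \in U -> orth_proj U *m v = v.
Proof.
rewrite mem_vbasis_mx => vU; apply: trmx_inj.
by rewrite trmx_mul trmxK proj_ortho_id.
Qed.

Lemma orth_proj_ortho (U : {vspace 'cV[C]_d}) (u v : 'cV[C]_d) :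
  u \in U -> u ^t* *m (v - orth_proj U *m v) = 0.
Proof.
rewrite mem_vbasis_mx => uU.
have := proj_ortho_compl_sub (\matrix_(i < \dim U) ((vbasis U)`_i)^T) v^T.
set w := (X in (X <= _)%MS) => wU.
have -> : v - orth_proj U *m v = w^T.
  by rewrite /w raddfB /= trmx_mul trmxK.
have /orthomx1P h : (w <= orthomx Num.conj (mx_of_hermitian (hermitian1mx _)) u^T)%MS.
  apply: submx_trans wU _; rewrite orthomx_sym.
  by apply: submx_trans uU _; rewrite orthomx_sym.
by apply: trmx_inj; rewrite trmx_mul trmxK trmx0 map_trmx trmxK -[RHS]h trmxK.
Qed.

End OrthogonalProjection.

Section Qubits.
Variable C : numClosedFieldType.

Definition ket (b : 'I_2) : 'cV[C]_2 := delta_mx b 0.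

(* v_1 \otimes ... \otimes v_N *)
Definition tensor_vec N (v : 'I_N -> 'cV[C]_2) : 'cV[C]_(qdim N) :=
  \col_k \prod_(i < N) v i ((enum_val k : bitstring N) i) 0.

(* A_1 \otimes ... \otimes A_N *)
Definition tensor_op N (A : 'I_N -> 'M[C]_2) : 'M[C]_(qdim N) :=
  \matrix_(k, l) \prod_(i < N)
    A i ((enum_val k : bitstring N) i) ((enum_val l : bitstring N) i).

Definition dicke N (n : nat) : 'cV[C]_(qdim N) :=
  \sum_(x : bitstring N | #|[set i | x i == 0]| == n)
    tensor_vec (fun i => ket (x i)).

Definition dual_dicke N (n : nat) : 'cV[C]_(qdim N) :=
  ('C(N, n)%:R)^-1 *: dicke N n.

Lemma tensor_ketE N (x : bitstring N) :
  tensor_vec (fun i => ket (x i)) = delta_mx (enum_rank x) 0.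
Proof.
apply/colP => k; rewrite !mxE eqxx andbT -(inj_eq enum_val_inj) enum_rankK.
case: eqP => [->|kx]; first by rewrite big1 // => i _; rewrite mxE !eqxx.
have [i kxi] : exists i, (enum_val k : bitstring N) i != x i.
  by apply/existsP; apply: contra_notT kx => /existsPn kx; apply/ffunP => i;
     apply/eqP/negPn.
by rewrite (bigD1 i) //= mxE (negPf kxi) mul0r.
Qed.

Lemma dickeE N n (k : 'I_(qdim N)) :
  dicke N n k 0 = (#|[set i | (enum_val k : bitstring N) i == 0]| == n)%:R.
Proof.
rewrite summxE big_mkcond (bigD1 (enum_val k)) //= big1 => [|x xNk].
  rewrite addr0 tensor_ketE mxE enum_valK !eqxx /=.
  by case: (_ == n).
case: ifP => // _; rewrite tensor_ketE mxE -(inj_eq enum_val_inj) enum_rankK.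
by rewrite eq_sym (negPf xNk).
Qed.

Lemma dicke_generating N (z : C) :
  tensor_vec (fun _ : 'I_N => ket 1 + z *: ket 0) =
    \sum_(n < N.+1) z ^+ n *: dicke N n.
Proof.
apply/colP => k; rewrite mxE summxE.
pose x : bitstring N := enum_val k.
have nx : (#|[set i | x i == 0%R]| < N.+1)%N.
  by rewrite ltnS -[X in (_ <= X)%N](card_ord N) max_card.
rewrite [RHS](bigD1 (Ordinal nx)) //= [X in _ = _ + X]big1 => [|n nNx]; last first.
  by rewrite mxE dickeE -/x eq_sym (negPf (nNx : n != _ :> nat)) mulr0.
rewrite [X in _ = X + _]mxE dickeE -/x eqxx mulr1 addr0 -prodr_const.
rewrite [RHS]big_mkcond; apply: eq_bigr => i _; rewrite inE !mxE.
by case: (x i) => [[|[|//]] ?]; rewrite /= ?mulr0 ?mulr1 ?addr0 ?add0r.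
Qed.

Lemma dual_dickeP N (m n : nat) : (n <= N)%N ->
  (dicke N m) ^t* *m dual_dicke N n = (m == n)%:R%:M.
Proof.
move=> leN; apply/matrixP => a b; rewrite !ord1 !mxE eqxx mulr1n.
under eq_bigr => k _ do rewrite !mxE !dickeE conjC_nat mulrCA -natrM mulnb.
rewrite -mulr_sumr -natr_sum (reindex enum_rank) /=; last first.
  by exists enum_val => x _; [exact: enum_rankK|exact: enum_valK].
under eq_bigr => x _ do rewrite enum_rankK.
have [->|mn] := eqVneq m n; last first.
  by rewrite big1 ?mulr0 // => x _; case: eqP => // ->; rewrite (negPf mn).
under eq_bigr => x _ do rewrite andbb.
rewrite -big_mkcond /= sum1dep_card.
have <- : #|[set A : {set 'I_N} | #|A| == n]| = 
   #|[set x : bitstring N | #|[set i | x i == 0]| == n]|.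
  pose f (x : bitstring N) := [set i | x i == 0].
  pose h (A : {set 'I_N}) : bitstring N := [ffun i => if i \in A then 0 else 1].
  have fK : cancel f h.
    move=> x; apply/ffunP => i; rewrite ffunE inE.
    by case: (x i) => [[|[|//]] ?]; apply: val_inj.
  have fK' : cancel h f.
    by move=> A; apply/setP => i; rewrite inE ffunE; case: (i \in A).
  rewrite -(card_imset _ (can_inj fK)); congr #|pred_of_set _|.
  apply/setP => A; apply/idP/imsetP => [|[x]].
    by move=> hA; exists (h A); rewrite ?fK' // inE -/(f _) fK'; rewrite inE in hA.
  by rewrite inE => hx ->; rewrite inE.
rewrite card_draws card_ord mulVf // pnatr_eq0 -lt0n bin_gt0 //.
Qed.

(* The swap of the tensor factors i and j, as an operator: it maps the basis
   vector of a bit string y to that of y with the entries i, j exchanged. *)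
Definition swap_op N (i j : 'I_N) : 'M[C]_(qdim N) :=
  \matrix_(k, l) ((enum_val k : bitstring N) ==
    [ffun t => (enum_val l : bitstring N) (tperm i j t)])%:R.

Definition bosonic_space N : {vspace 'cV[C]_(qdim N)} :=
  (\bigcap_(i < N) \bigcap_(j < N) fixedSpace (linfun (mulmx (swap_op i j))))%VS.

Definition bosonic_proj N : 'M[C]_(qdim N) := orth_proj (bosonic_space N).

Lemma swap_op_tensor N (i j : 'I_N) (v : 'I_N -> 'cV[C]_2) :
  swap_op i j *m tensor_vec v = tensor_vec (fun t => v (tperm i j t)).
Proof.
apply/colP => k; rewrite !mxE.
pose y : bitstring N := [ffun t => (enum_val k : bitstring N) (tperm i j t)].
rewrite (bigD1 (enum_rank y)) //= big1 => [|l lNy]; last first.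
  rewrite !mxE; case: eqP => [kl | _]; last by rewrite mul0r.
  case/eqP: lNy; rewrite -[LHS]enum_valK; congr enum_rank.
  by apply/ffunP => t; rewrite ffunE kl ffunE tpermK.
rewrite addr0 !mxE enum_rankK.
have -> : (enum_val k : bitstring N) == [ffun t => y (tperm i j t)].
  by apply/eqP/ffunP => t; rewrite !ffunE tpermK.
rewrite mul1r (reindex_inj (@perm_inj _ (tperm i j))) /=.
by apply: eq_bigr => t _; rewrite ffunE tpermK.
Qed.

Lemma mem_bosonic_space N (v : 'cV[C]_(qdim N)) :
  reflect (forall i j : 'I_N, swap_op i j *m v = v) (v \in bosonic_space N).
Proof.
apply: (iffP idP) => [vS i j | vS].
  have /subvP/(_ v vS) : (bosonic_space N <=
      fixedSpace (linfun (mulmx (swap_op i j))))%VS.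
    by rewrite /bosonic_space (bigD1 i) //= (bigD1 j) //= -capvA capvSl.
  by move/fixedSpaceP; rewrite lfunE.
rewrite memvE; apply/subv_bigcapP => i _; apply/subv_bigcapP => j _.
by rewrite -memvE; apply/fixedSpaceP; rewrite lfunE /= vS.
Qed.

(* In C the inequality 0 <= t says that t is real and nonnegative. *)
Definition separability_witness N (W : 'M[C]_(qdim N)) : Prop :=
  [/\ W \is hermsymmx,
      W = bosonic_proj N *m W *m bosonic_proj N &
      forall alpha : 'cV[C]_2,
        0 <= \tr (W *m tensor_op (fun _ : 'I_N => alpha *m alpha ^t* ))].

Definition power_vec N (z : C) : 'cV[C]_N.+1 := \col_i z ^+ i.

Definition power_positive N (M : 'M[C]_N.+1) : Prop :=
  forall z : C, 0 <= ((power_vec N z) ^t* *m M *m power_vec N z) 0 0.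

End Qubits.

(* Main.v *)
(* Let U be the matrix whose columns are the dual Dicke vectors, so that
   W = U M U^*.  For alpha = a|0> + b|1> the vector alpha^{(x) N} has Dicke
   coordinates q_n = a^n b^(N-n), so duality gives
   tr (W (alpha alpha^* )^{(x) N}) = q^* M q.  If b <> 0 then q is b^N times the
   power vector of a/b.  If b = 0 the value is |a|^(2N) m_{N,N}, and
   m_{N,N} >= 0 because q^* M q = m_{N,N} + O(e) for a = 1, b = e -> 0+. *)
Require Import Defs.
From mathcomp Require Import all_boot all_order all_fingroup all_algebra.
From mathcomp Require Import sesquilinear spectral complex reals ring.
Set Implicit Arguments.
Unset Strict Implicit.
Unset Printing Implicit Defensive.
Import Order.TTheory GRing.Theory Num.Theory.
Local Open Scope ring_scope.
Local Open Scope sesquilinear_scope.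

Section Witness.
Variable C : numClosedFieldType.

(** A swap permutes the bit strings and keeps the number of zeros, so it only reorders the terms of
    the Dicke sum. *)
Lemma dicke_bosonic N n : dicke C N n \in bosonic_space C N.
Proof.
apply/mem_bosonic_space => i j; rewrite /dicke mulmx_sumr.
pose f (x : bitstring N) : bitstring N := [ffun t => x (tperm i j t)].
have fK : involutive f by move=> x; apply/ffunP => t; rewrite !ffunE tpermK.
rewrite [RHS](reindex_inj (inv_inj fK)) /=; apply: eq_big => x.
  congr (_ == n); rewrite -[RHS](card_imset _ (@perm_inj _ (tperm i j))).
  apply: eq_card => t; rewrite -{2}[t](tpermK i j).
  by rewrite (mem_imset _ _ (@perm_inj _ (tperm i j))) !inE ffunE tpermK.
move=> _; rewrite swap_op_tensor; apply/colP => k; rewrite !mxE.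
by apply: eq_bigr => t _; rewrite ffunE.
Qed.

Lemma tensor_opE N (v : 'cV[C]_2) :
  tensor_op (fun _ : 'I_N => v *m v ^t* ) =
  tensor_vec (fun _ : 'I_N => v) *m (tensor_vec (fun _ : 'I_N => v)) ^t*.
Proof.
apply/matrixP => k l; rewrite !mxE big_ord1 !mxE rmorph_prod -big_split.
by apply: eq_bigr => i _; rewrite !mxE big_ord1 !mxE.
Qed.

(** Homogenization of [power_vec], which is the case b = 1; the point at infinity b = 0 is
    included. *)
Definition hpower_vec N (a b : C) : 'cV[C]_N.+1 := \col_i (a ^+ i * b ^+ (N - i)).

Definition dual_dicke_mx N : 'M[C]_(qdim N, N.+1) :=
  \matrix_(k, j) dual_dicke C N j k 0.

(** Homogeneous counterpart of [dicke_generating]: at a given bit string only the Dicke vector with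
    the same number of zeros contributes. *)
Lemma tensor_vecE N (v : 'cV[C]_2) :
  tensor_vec (fun _ : 'I_N => v) =
  \sum_(n < N.+1) hpower_vec N (v 0 0) (v 1 0) n 0 *: dicke C N n.
Proof.
apply/colP => k; rewrite mxE summxE.
pose x : bitstring N := enum_val k.
pose A := [set i | x i == 0%R].
have leA : (#|A| < N.+1)%N.
  by rewrite ltnS -[X in (_ <= X)%N](card_ord N) max_card.
rewrite (bigD1 (Ordinal leA)) //= [X in _ = _ + X]big1 => [|n nNx]; last first.
  by rewrite mxE dickeE -/x eq_sym (negPf (nNx : n != _ :> nat)) mulr0.
rewrite [X in _ = X + _]mxE dickeE -/x eqxx mulr1 addr0 mxE /=.
have -> : (N - #|A| = #|~: A|)%N by rewrite [RHS]cardsCs setCK card_ord.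
rewrite (bigID [in A]) /= -2!prodr_const; congr (_ * _).
  by apply: eq_bigr => i; rewrite inE => /eqP ->.
apply: eq_big => [i|i]; rewrite !inE // -/x.
by case: (x i) => [[|[|//]] ?] //= _; congr (v _ 0); apply: val_inj.
Qed.

Lemma dual_dicke_mx_tensor N (v : 'cV[C]_2) :
  (dual_dicke_mx N) ^t* *m tensor_vec (fun _ : 'I_N => v) =
  hpower_vec N (v 0 0) (v 1 0).
Proof.
rewrite tensor_vecE mulmx_sumr; apply/colP => i; rewrite summxE.
have dd (n : 'I_N.+1) :
    ((dual_dicke_mx N) ^t* *m dicke C N n) i 0 = (n == i)%:R.
  (* [dual_dickeP] has the dual vector on the right, so its adjoint is taken; the value 0 or 1 is
     real. *)
  have := dual_dickeP C n (leq_ord i) => /(congr1 (fun X => (X ^t*) 0 0)).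
  rewrite trmx_mul map_mxM trmxCK.
  rewrite !mxE eqxx conjC_nat => <-.
  by apply: eq_bigr => k _; rewrite !mxE.
rewrite (bigD1 i) //= big1 => [|n nNi]; rewrite -scalemxAr mxE dd.
  by rewrite eqxx mulr1 addr0.
by rewrite (negPf nNi) mulr0.
Qed.

Lemma witness_mxE N (M : 'M[C]_N.+1) :
  \sum_(i < N.+1) \sum_(j < N.+1)
     M i j *: (dual_dicke C N i *m (dual_dicke C N j) ^t* ) =
  dual_dicke_mx N *m M *m (dual_dicke_mx N) ^t*.
Proof.
apply/matrixP => k l; rewrite summxE [RHS]mxE.
under [RHS]eq_bigr do rewrite mxE mulr_suml.
rewrite [RHS]exchange_big; apply: eq_bigr => i _; rewrite summxE.
apply: eq_bigr => j _; rewrite !mxE big_ord1 !mxE.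
by rewrite mulrA [_ * M i j]mulrC.
Qed.

Lemma bosonic_proj_dual_dicke_mx N :
  bosonic_proj C N *m dual_dicke_mx N = dual_dicke_mx N.
Proof.
have colU j : col j (dual_dicke_mx N) = dual_dicke C N j.
  by apply/colP => k; rewrite !mxE.
suff h j : col j (bosonic_proj C N *m dual_dicke_mx N) = col j (dual_dicke_mx N).
  by apply/matrixP => k j; have /colP/(_ k) := h j; rewrite !mxE.
rewrite colE -mulmxA -colE colU; apply: orth_proj_id.
by rewrite memvZ // dicke_bosonic.
Qed.

(** The rows are adjoints of vectors of the bosonic space, and these annihilate the range of 1 - P
    by [orth_proj_ortho]. *)
Lemma dual_dicke_mx_bosonic_proj N :
  (dual_dicke_mx N) ^t* *m bosonic_proj C N = (dual_dicke_mx N) ^t*.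
Proof.
suff h j : row j ((dual_dicke_mx N) ^t* ) *m (1%:M - bosonic_proj C N) = 0.
  apply/row_matrixP => j; rewrite row_mul; apply/esym/eqP.
  by rewrite -subr_eq0 -{1}[row _ _]mulmx1 -mulmxBr h.
have -> : row j ((dual_dicke_mx N) ^t* ) = (dual_dicke C N j) ^t*.
  by apply/rowP => k; rewrite !mxE.
have dS : dual_dicke C N j \in bosonic_space C N.
  by rewrite memvZ // dicke_bosonic.
apply/rowP => k; have /matrixP/(_ 0 0) := orth_proj_ortho (delta_mx k 0) dS.
by rewrite -{1}[delta_mx k 0]mul1mx -mulmxBl mulmxA -colE !mxE.
Qed.

Lemma tr_witness_mx N (M : 'M[C]_N.+1) (v : 'cV[C]_2) :
  let q := hpower_vec N (v 0 0) (v 1 0) in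
  \tr (dual_dicke_mx N *m M *m (dual_dicke_mx N) ^t* *m
       tensor_op (fun _ : 'I_N => v *m v ^t* )) = (q ^t* *m M *m q) 0 0.
Proof.
move=> /=; rewrite tensor_opE -dual_dicke_mx_tensor.
set T := tensor_vec _; set U := dual_dicke_mx N.
(* Cyclicity moves the adjoint of [T] to the front, leaving the trace of a 1 x 1 matrix. *)
rewrite mulmxA mxtrace_mulC trmx_mul map_mxM trmxCK.
by rewrite /mxtrace big_ord1 !mulmxA.
Qed.

Lemma hpower_vec_scale N (a b : C) : b != 0 ->
  hpower_vec N a b = b ^+ N *: power_vec N (a / b).
Proof.
move=> b0; apply/colP => i; rewrite !mxE expr_div_n.
have -> : b ^+ N = b ^+ (N - i) * b ^+ i by rewrite -exprD subnK ?leq_ord.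
by rewrite mulrACA divff ?expf_neq0 // mulr1 mulrC.
Qed.

Lemma form_scale N (M : 'M[C]_N) (c : C) (q : 'cV[C]_N) :
  ((c *: q) ^t* *m M *m (c *: q)) 0 0 = `|c| ^+ 2 * (q ^t* *m M *m q) 0 0.
Proof.
have -> : (c *: q) ^t* = c^* *: q ^t* by apply/rowP => j; rewrite !mxE rmorphM.
rewrite -!scalemxAl -scalemxAr scalerA mxE.
by rewrite [_ * c]mulrC -normCK.
Qed.

Lemma formE N (M : 'M[C]_N) (q : 'cV[C]_N) :
  (q ^t* *m M *m q) 0 0 = \sum_i \sum_j (q i 0)^* * M i j * q j 0.
Proof.
rewrite mxE exchange_big; apply: eq_bigr => j _.
by rewrite mxE mulr_suml; apply: eq_bigr => i _; rewrite !mxE.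
Qed.


(** An algebraic substitute for letting e tend to 0. Realness of [a] makes it comparable with 0 in
    the partial order of [C]. *)
Lemma ge0_of_small_perturbations (a s : C) : a \is Num.real -> 0 <= s ->
  (forall e, 0 < e <= 1 -> 0 <= a + e * s) -> 0 <= a.
Proof.
move=> aR s0 h; rewrite real_leNgt ?real0 //; apply/negP => a0.
have as0 : 0 < s - a by rewrite ltr_wpDl // oppr_gt0.
(* The denominator is positive even when s = 0, the quotient is at most 1, and the perturbed value
   is - a^2 / (s - a) < 0. *)
have := h (- a / (s - a)); rewrite divr_gt0 ?oppr_gt0 // ler_pdivrMr // mul1r.
rewrite lerDr s0 => /(_ isT).
have -> : a + - a / (s - a) * s = - (a ^+ 2 / (s - a)).
  by field; rewrite lt0r_neq0.
by rewrite oppr_ge0 lt_geF // divr_gt0 // expr2 nmulr_rgt0.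
Qed.

Lemma form_hermitian_real N (M : 'M[C]_N) (q : 'cV[C]_N) :
  M \is hermsymmx -> (q ^t* *m M *m q) 0 0 \is Num.real.
Proof.
move/is_hermitianmxP; rewrite expr0 scale1r => MH.
rewrite CrealE; apply/eqP.
have -> : ((q ^t* *m M *m q) 0 0)^* = ((q ^t* *m M *m q) ^t*) 0 0.
  by rewrite [RHS]mxE [in RHS]mxE.
by rewrite !trmx_mul !map_mxM trmxCK -MH mulmxA.
Qed.

Lemma power_positive_corner N (M : 'M[C]_N.+1) : M \is hermsymmx ->
  power_positive M -> 0 <= M ord_max ord_max.
Proof.
move=> MH Mp.
pose q e := hpower_vec N 1 e.
have qform0 : (((q 0) ^t* *m M *m q 0) 0 0) = M ord_max ord_max.
  (* Since [0 ^+ 0 = 1], only the coordinate of index N survives at e = 0. *)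
  have -> : q 0 = delta_mx ord_max 0.
    apply/colP => i; rewrite !mxE expr1n mul1r expr0n subn_eq0 eqxx andbT.
    by rewrite -(inj_eq val_inj) eqn_leq leq_ord.
  by rewrite trmx_delta map_delta_mx -rowE -colE !mxE.
have MR : M ord_max ord_max \is Num.real.
  by rewrite -qform0 form_hermitian_real.
(* This sum of the norms of all entries is the constant in the O(e) bound. *)
pose s := \sum_(p : 'I_N.+1 * 'I_N.+1) `|M p.1 p.2|.
have s0 : 0 <= s by apply: sumr_ge0.
apply: (ge0_of_small_perturbations MR s0) => e /andP[e0 e1].
have fe : 0 <= ((q e) ^t* *m M *m q e) 0 0.
  by rewrite /q hpower_vec_scale ?gt_eqF // form_scale mulr_ge0 ?exprn_ge0.
set r := ((q e) ^t* *m M *m q e) 0 0 - M ord_max ord_max.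
have rR : r \is Num.real by rewrite realB // ger0_real.
suff rs : `|r| <= e * s.
  apply: le_trans fe _; rewrite -lerBlDl.
  by apply: le_trans rs; exact: real_ler_norm.
(* Every entry other than (N, N) carries at least one factor e <= 1. *)
rewrite /r formE pair_bigA (bigD1 (ord_max, ord_max)) //=.
rewrite !mxE subnn !expr1n !mulr1 conjC1 mul1r addrAC subrr add0r.
apply: le_trans (ler_norm_sum _ _ _) _.
(* The corner also occurs in [s]; its contribution is nonnegative and is dropped before comparing
   termwise. *)
rewrite /s mulr_sumr [leRHS](bigD1 (ord_max, ord_max)) //=.
apply: ler_wpDl; first by rewrite mulr_ge0 // ltW.
apply: ler_sum => -[i j] /=; rewrite xpair_eqE => ij.
rewrite !mxE !expr1n !mul1r !normrM norm_conjC !normrX (gtr0_norm e0).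
rewrite mulrAC -exprD ler_wpM2r //.
(* The exponent of e is zero only for i = j = N, the excluded pair. *)
case E: (N - i + (N - j))%N => [|k].
  move: ij; rewrite -!(inj_eq val_inj) !eqn_leq !leq_ord /=.
  by move/eqP: E; rewrite addn_eq0 !subn_eq0 => ->.
by rewrite exprS ler_piMr ?(ltW e0) // exprn_ile1 // ltW.
Qed.

Lemma power_positive_hpower N (M : 'M[C]_N.+1) (a b : C) : M \is hermsymmx ->
  power_positive M ->
  0 <= ((hpower_vec N a b) ^t* *m M *m hpower_vec N a b) 0 0.
Proof.
move=> MH Mp; have [->|b0] := eqVneq b 0; last first.
  by rewrite hpower_vec_scale // form_scale mulr_ge0 ?exprn_ge0.
have -> : hpower_vec N a 0 = a ^+ N *: delta_mx ord_max 0.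
  apply/colP => i; rewrite !mxE expr0n subn_eq0 eqxx andbT.
  have -> : (N <= i)%N = (i == ord_max) by rewrite -(inj_eq val_inj) eqn_leq leq_ord.
  by have [->|] := eqVneq i ord_max; rewrite ?mulr0.
rewrite form_scale mulr_ge0 ?exprn_ge0 //.
rewrite trmx_delta map_delta_mx -rowE -colE !mxE.
exact: power_positive_corner.
Qed.

Lemma witness_mx_herm N (M : 'M[C]_N.+1) : M \is hermsymmx ->
  dual_dicke_mx N *m M *m (dual_dicke_mx N) ^t* \is hermsymmx.
Proof.
move=> /is_hermitianmxP; rewrite expr0 scale1r => MH.
apply/is_hermitianmxP; rewrite expr0 scale1r !trmx_mul !map_mxM trmxCK.
by rewrite -MH mulmxA.
Qed.

End Witness.

Local Open Scope complex_scope.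

Theorem mainTheorem4 (R : realType) (N : nat) (M : 'M[R[i]]_N.+1) :
  (1 <= N)%N ->
  M \is hermsymmx ->
  separability_witness
    (\sum_(i < N.+1) \sum_(j < N.+1)
       M i j *: (dual_dicke R[i] N i *m (dual_dicke R[i] N j) ^t* ))
  <-> power_positive M.
Proof.
move=> _ MH; rewrite witness_mxE; split=> [[_ _ Wp] z | Mp].
  (* The vector z|0> + |1> has b = 1, so its tensor power has Dicke coordinates [power_vec N z] with
     scale factor 1. *)
  pose v : 'cV[R[i]]_2 := \col_i (if i == 0 then z else 1).
  have [v0 v1] : v 0 0 = z /\ v 1 0 = 1 by rewrite !mxE.
  have := Wp v; rewrite tr_witness_mx v0 v1 hpower_vec_scale ?oner_eq0 //.
  by rewrite form_scale expr1n normr1 expr1n mul1r divr1.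
split=> [||v]; first exact: witness_mx_herm.
  rewrite !mulmxA bosonic_proj_dual_dicke_mx.
  by rewrite -(mulmxA _ _ (bosonic_proj _ _)) dual_dicke_mx_bosonic_proj.
by rewrite tr_witness_mx power_positive_hpower.
Qed.
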